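(* Let $v\in\mathbb{N}\setminus\{1\}$ and let $h\colon\mathbb{N}_2\to\mathbb{R}_{\ge0}$ be a $v$-transitive convex light weight such that $v\in V(h)$. If $B_h(1)_1=+\infty$ then $\lim_{n\to\infty}a_n^{h,v}=1$.
   Context: $\mathbb{N}=\{1,2,\dots\}$, $\mathbb{N}_0=\{0,1,2,\dots\}$, and $\mathbb{N}_2=\{e\subset\mathbb{N}:|e|=2\}$. A weight is a map $h\colon\mathbb{N}_2\to\mathbb{C}$ (here with values in $\mathbb{R}_{\ge0}$). A walk of length $n\in\mathbb{N}_0$ is a tuple $w=\langle v_0,\dots,v_n\rangle$ of elements of $\mathbb{N}$ with $v_{i-1}\ne v_i$ for $i=1,\dots,n$; its weight is $h(w)=\prod_{i=1}^n h(\{v_{i-1},v_i\})$ (and $h(w)=1$ if $n=0$). For a set $W$ of walks, $h(W)$ denotes the sum of $\sum_{w\in W}h(w)$ when it converges absolutely. $W(n)$ is the set of walks of length $n$ with $v_0=1$. The weight $h$ is light if $\sum_{w\in W(n)}h(w)$ converges absolutely for every $n\in\mathbb{N}_0$. $V(h)$ is the set of vertices $u\in\mathbb{N}$ such that some walk starting at $1$ and ending at $u$ has nonzero weight. A light weight $h$ is convex if for every $u\in V(h)$, $\sum_{w\in\mathbb{N}\setminus\{u\}}h(\{u,w\})=1$. For $v\in\mathbb{N}\setminus\{1\}$, $h$ is $v$-transitive if there is a bijection $f\colon\mathbb{N}\to\mathbb{N}$ with $f(1)=v$ and $h(\{f(a),f(b)\})=h(\{a,b\})$ for all $\{a,b\}\in\mathbb{N}_2$.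 Let $a_n^{h,v}=h(W(v,n))$, where $W(v,n)$ is the set of walks in $W(n)$ visiting $v$. $B_h(x)=\sum_{n\ge0}b_n^hx^n$ with $b_n^h$ the weight of the walks of length $n$ with $v_0=v_n=1$. For $U(x)=\sum_{n\ge0}u_nx^n\in\mathbb{R}[[x]]$, $U(1)_1=+\infty$ means $\lim_{n\to\infty}\sum_{j=0}^nu_j=+\infty$. *)

(* Defs.v *)
From HB Require Import structures.
From mathcomp Require Import all_boot all_order all_algebra finmap.
From mathcomp Require Import all_classical all_reals all_analysis.
Set Implicit Arguments.
Unset Strict Implicit.
Unset Printing Implicit Defensive.
Import Order.TTheory GRing.Theory Num.Theory numFieldNormedType.Exports.
Local Open Scope classical_set_scope.
Local Open Scope ring_scope.

Definition vertex : choiceType := {n : nat | (0 < n)%N}.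

Definition vertex1 : vertex := exist _ 1%N isT.

Definition edge : choiceType := {e : {fset vertex} | #|` e| == 2%N}.

Definition weight (R : realType) := edge -> {nonneg R}.

Section Walks.
Variable R : realType.
Implicit Types (h : weight R) (u v : vertex) (n : nat) (w : seq vertex).

(* h({u, v}) when u != v; {u, u} is not an edge, and the value 0 returned for
   it is never used: the definitions below only evaluate at u != v. *)
Definition edge_weight h u v : R :=
  if insub [fset u; v]%fset is Some e then (h e)%:num else 0.

Definition is_walk n w : bool :=
  (size w == n.+1) && sorted (fun x y => x != y) w.

Definition walk_weight h w : R :=
  \prod_(1 <= i < size w) edge_weight h (nth vertex1 w i.-1) (nth vertex1 w i).

(* Since h >= 0, absolute convergence is finiteness of esum, the supremum of
   the finite partial sums; fine returns 0 for divergent families. *)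
Definition set_weight h (W : set (seq vertex)) : R :=
  fine (\esum_(w in W) (walk_weight h w)%:E).

Definition walks n : set (seq vertex) :=
  [set w | is_walk n w /\ head vertex1 w = vertex1].

Definition walks_visiting v n : set (seq vertex) :=
  walks n `&` [set w | v \in w].

Definition closed_walks n : set (seq vertex) :=
  walks n `&` [set w | last vertex1 w = vertex1].

Definition light h : Prop :=
  forall n, summable (walks n) (fun w => (walk_weight h w)%:E).

Definition reachable h : set vertex :=
  [set u | exists n w, [/\ walks n w, last vertex1 w = u & walk_weight h w != 0]].

Definition convex_weight h : Prop :=
  light h /\
  forall u, reachable h u ->
    \esum_(w in [set w | w != u]) (edge_weight h u w)%:E = 1%E.

Definition transitive_at v h : Prop :=
  exists f : vertex -> vertex,
    [/\ bijective f, f vertex1 = v &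
        forall a b, a != b -> edge_weight h (f a) (f b) = edge_weight h a b].

Definition a_ h v n : R := set_weight h (walks_visiting v n).

Definition b_ h n : R := set_weight h (closed_walks n).

(* A formal power series over R is given by its sequence of coefficients. *)
Definition diverges_at_1 (U : nat -> R) : Prop :=
  (\sum_(0 <= j < n.+1) U j) @[n --> \oo] --> +oo.

End Walks.

(* Main.v *)
(* View [h] as a symmetric transition kernel [P], stochastic on the set [V(h)].
   Let [a u] be the limit of the weight of the walks of length [n] from [u] that
   visit [v].  Then [0 <= a <= 1], [a v = 1] and [a] is superharmonic.
   Transitivity turns the divergence of [B_h] at 1 into recurrence at [v], and a
   bounded superharmonic function [f] satisfies [P^m f v = f v] for every [m].
   Hence [P^m a v = 1], and integrating [a + (1 - a 1) 1_1 <= 1] gives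
   [(1 - a 1) P^m(v, 1) <= 0] for all [m].  By symmetry of [h], [P^m(v, 1) > 0]
   for some [m], so [a 1 = 1]. *)

Require Import Defs.
From mathcomp Require Import all_boot all_order all_algebra finmap.
From mathcomp Require Import all_classical all_reals all_analysis.
Set Implicit Arguments.
Unset Strict Implicit.
Unset Printing Implicit Defensive.
Import Order.TTheory GRing.Theory Num.Theory numFieldNormedType.Exports.
Local Open Scope classical_set_scope.
Local Open Scope ring_scope.

(** * Sums of nonnegative extended real families *)

Lemma esumZl (R : realType) (T : choiceType) (S : set T) (c : R)
    (F : T -> \bar R) : 0 <= c -> (forall i, (0 <= F i)%E) ->
  \esum_(i in S) (c%:E * F i)%E = (c%:E * \esum_(i in S) F i)%E.
Proof.
move=> c0 F0; rewrite /esum -ereal_supZl//; last first.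
  apply/set0P; exists (\sum_(x \in set0) F x)%E.
  by exists set0 => //; exact: fsets_set0.
rewrite image_comp; congr ereal_sup; apply: eq_imagel => A _ /=.
by rewrite -ge0_mule_fsumr.
Qed.

(** A form of Fatou's lemma: each finite partial sum passes to the limit, and the sum is the
    supremum of these. *)
Lemma esum_limit_le (R : realType) (T : choiceType) (S : set T)
    (F : nat -> T -> \bar R) (G : T -> \bar R) (M : \bar R) :
  (forall n i, (0 <= F n i)%E) ->
  (forall i, F ^~ i @ \oo --> G i) ->
  (forall n, (\esum_(i in S) F n i <= M)%E) ->
  (\esum_(i in S) G i <= M)%E.
Proof.
move=> F0 FG FM; apply: ge_ereal_sup => _ [A [finA AS] <-].
rewrite fsbig_finite//.
have : (\sum_(i <- fset_set A) F n i)%E @[n --> \oo] -->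
    (\sum_(i <- fset_set A) G i)%E.
  by apply: cvg_nnesum => i _; [exact: nearW|exact: FG].
apply: cvge_le; apply: nearW => n.
rewrite -fsbig_finite//; apply: le_trans (FM n).
by apply: ereal_sup_ubound; exists A.
Qed.

Lemma esum_size_recl (R : realType) (T : choiceType) (n : nat)
    (F : seq T -> \bar R) : (forall s, (0 <= F s)%E) ->
  \esum_(s in [set s | size s = n.+1]) F s =
  \esum_(x in setT) \esum_(s in [set s | size s = n]) F (x :: s).
Proof.
move=> F0; rewrite esum_esum//.
apply: (@reindex_esum _ _ _ _ _ (fun xs => xs.1 :: xs.2)); split.
- by move=> [x s] [_ /= <-].
- by move=> [x s] [y t] _ _ /= [-> ->].
- by case=> [//|x s] /= [sn]; exists (x, s).
Qed.

(** * The operator [P] of a nonnegative kernel and its powers *)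

Section TransitionOperator.
Local Open Scope ereal_scope.
Variables (R : realType) (T : choiceType) (p : T -> T -> R).
Hypothesis p_ge0 : forall u w, (0 <= p u w)%R.
Implicit Types (f g : T -> \bar R) (u v w : T) (s : seq T).

Definition transition f u : \bar R := \esum_(w in setT) (p u w)%:E * f w.

Fixpoint path_weight u s : R :=
  if s is x :: s' then (p u x * path_weight x s')%R else 1%R.

(** The indicator of [v]; applying [P^k] to it gives the [k]-step weight from [u] to [v]. *)
Definition dirac_at v u : \bar R := if u == v then 1 else 0.

Lemma path_weight_ge0 u s : (0 <= path_weight u s)%R.
Proof. by elim: s u => //= x s IH u; rewrite mulr_ge0. Qed.

Lemma path_weight_rcons u s x :
  path_weight u (rcons s x) = (path_weight u s * p (last u s) x)%R.
Proof.
by elim: s u => [|y s IH] u /=; rewrite ?mul1r ?mulr1// IH mulrA.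
Qed.

Lemma dirac_at_ge0 v u : 0 <= dirac_at v u.
Proof. by rewrite /dirac_at; case: ifP. Qed.

Lemma transition_ge0 f u : (forall w, 0 <= f w) -> 0 <= transition f u.
Proof. by move=> f0; apply: esum_ge0 => w _; rewrite mule_ge0// lee_fin. Qed.

Lemma iter_transition_ge0 n f u :
  (forall w, 0 <= f w) -> 0 <= iter n transition f u.
Proof.
move=> f0; elim: n u => [|n IH] u //=.
exact: transition_ge0.
Qed.

Lemma transitionD f g : (forall w, 0 <= f w) -> (forall w, 0 <= g w) ->
  transition (f \+ g) = transition f \+ transition g.
Proof.
move=> f0 g0; apply/funext => u; rewrite /transition /= -esumD.
- by apply: eq_esum => w _; rewrite ge0_muleDr.
- by move=> w _; rewrite mule_ge0// lee_fin.
- by move=> w _; rewrite mule_ge0// lee_fin.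
Qed.

Lemma transitionZ (c : R) f : (0 <= c)%R -> (forall w, 0 <= f w) ->
  transition (fun w => c%:E * f w) = (fun u => c%:E * transition f u).
Proof.
move=> c0 f0; apply/funext => u; rewrite /transition -esumZl//.
  by apply: eq_esum => w _; rewrite muleCA.
by move=> w; rewrite mule_ge0// lee_fin.
Qed.

Lemma iter_transitionD n f g : (forall w, 0 <= f w) -> (forall w, 0 <= g w) ->
  iter n transition (f \+ g) = iter n transition f \+ iter n transition g.
Proof.
move=> f0 g0; elim: n => //= n ->.
by rewrite transitionD// => w; exact: iter_transition_ge0.
Qed.

Lemma iter_transitionZ n (c : R) f : (0 <= c)%R -> (forall w, 0 <= f w) ->
  iter n transition (fun w => c%:E * f w) =
  (fun u => c%:E * iter n transition f u).
Proof.
move=> c0 f0; elim: n => //= n ->.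
by rewrite transitionZ// => w; exact: iter_transition_ge0.
Qed.

Lemma transition_ge_term f u w : (forall w, 0 <= f w) ->
  (p u w)%:E * f w <= transition f u.
Proof.
move=> f0; have pf0 x : 0 <= (p u x)%:E * f x by rewrite mule_ge0// lee_fin.
by rewrite /transition (esumID [set w])// setTI esum_set1// leeDl// esum_ge0.
Qed.

(** Fatou for [P]. Convergence is asked only where [p u w] is nonzero, since the limits used later
    are controlled only on a closed set of states; the other terms are constantly 0. *)
Lemma transition_limit_le (f_ : nat -> T -> \bar R) f u (M : \bar R) :
  (forall n w, 0 <= f_ n w) ->
  (forall w, p u w != 0%R -> f_ ^~ w @ \oo --> f w) ->
  (forall n, transition (f_ n) u <= M) -> transition f u <= M.
Proof.
move=> f0 f_f fM; apply: esum_limit_le fM => [n w|w].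
  by rewrite mule_ge0// lee_fin.
have [->|pw] := eqVneq (p u w) 0%R.
  rewrite mul0e; under eq_fun do rewrite mul0e; exact: cvg_cst.
by apply: cvgeZl => //; exact: f_f.
Qed.

Lemma transition_equivariant (phi : T -> T) g : bijective phi ->
  (forall a b, p (phi a) (phi b) = p a b) ->
  transition g \o phi = transition (g \o phi).
Proof.
move=> bij_phi p_phi; apply/funext => u; rewrite /transition /=.
rewrite (@reindex_esum _ _ _ setT setT phi); last by rewrite setTT_bijective.
by apply: eq_esum => w _; rewrite p_phi.
Qed.

Lemma iter_transition_equivariant n (phi : T -> T) g : bijective phi ->
  (forall a b, p (phi a) (phi b) = p a b) ->
  iter n transition g \o phi = iter n transition (g \o phi).
Proof.
move=> bij_phi p_phi; elim: n => //= n <-.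
exact: transition_equivariant.
Qed.

(** Expands [P^n] over paths by splitting off the first step; this links the operator to sums over
    walks. *)
Lemma iter_transition_paths n g u : (forall w, 0 <= g w) ->
  iter n transition g u =
  \esum_(s in [set s | size s = n]) (path_weight u s)%:E * g (last u s).
Proof.
move=> g0; have pg0 x s : 0 <= (path_weight x s)%:E * g (last x s).
  by rewrite mule_ge0// lee_fin path_weight_ge0.
elim: n u => [|n IH] u.
  rewrite (_ : [set s | size s = 0%N] = [set [::]]) ?esum_set1 ?mul1e//.
  by apply/seteqP; split => s /=; [exact: size0nil|move=> ->].
rewrite esum_size_recl// iterS; apply: eq_esum => x _ /=.
rewrite IH -esumZl//; apply: eq_esum => s _.
by rewrite EFinM muleA.
Qed.


Lemma transition_le f g u : (forall w, p u w != 0%R -> f w <= g w) ->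
  transition f u <= transition g u.
Proof.
move=> fg; apply: le_esum => w _.
have [->|pw] := eqVneq (p u w) 0%R; first by rewrite !mul0e.
by apply: lee_wpmul2l; [rewrite lee_fin|exact: fg].
Qed.

(** * Superharmonic functions for a kernel stochastic on a closed set [V] *)

Section StochasticOn.
Variable V : set T.
Hypothesis V_closed : forall u w, V u -> p u w != 0%R -> V w.
Hypothesis transition1 : forall u, V u -> transition (cst 1) u = 1.

Definition superharmonic f := forall u, V u -> transition f u <= f u.

Definition hit_weight v n u : \bar R :=
  \esum_(s in [set s | size s = n])
    (path_weight u s)%:E * (if v \in u :: s then 1 else 0).

(** Paths of nonzero weight starting in [V] stay in [V], so a comparison on [V] suffices. *)
Lemma iter_transition_le n f g u : (forall w, V w -> f w <= g w) -> V u ->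
  iter n transition f u <= iter n transition g u.
Proof.
move=> fg; elim: n u => [|n IH] u Vu /=; first exact: fg.
by apply: transition_le => w pw; exact/IH/(V_closed Vu pw).
Qed.

Lemma iter_transition1 n u : V u -> iter n transition (cst 1) u = 1.
Proof.
elim: n u => [//|n IH] u Vu /=; rewrite -[RHS](transition1 Vu).
by apply/eqP; rewrite eq_le !transition_le// => w pw;
  rewrite IH//; exact: V_closed Vu pw.
Qed.

Lemma superharmonic_iter n f :
  superharmonic f -> superharmonic (iter n transition f).
Proof. by move=> fS u Vu; rewrite -iterS iterSr; exact: iter_transition_le. Qed.

(* With [d := f v - P f v], iterating [P f + d 1_v <= f] gives
   [d * \sum_(k < n) P^k 1_v v <= f v <= 1], so [d = 0]. *)
Lemma superharmonic_recurrent f v : V v -> (forall w, 0 <= f w) ->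
  (forall w, V w -> f w <= 1) -> superharmonic f ->
  (forall M : R, exists n,
     M%:E <= \sum_(k < n) iter k transition (dirac_at v) v) ->
  transition f v = f v.
Proof.
move=> Vv f0 f1 fS div; apply/eqP; rewrite eq_le fS//= leNgt.
apply/negP => lt_f.
have fv_fin : f v \is a fin_num.
  by rewrite fin_numElt (lt_le_trans (ltNyr 0))// (le_lt_trans (f1 v Vv)) ?ltry.
have Pfv_fin : transition f v \is a fin_num.
  rewrite fin_numElt (lt_le_trans (ltNyr 0)) ?transition_ge0//=.
  by rewrite (lt_trans lt_f)// -ge0_fin_numE.
pose d := (fine (f v) - fine (transition f v))%R.
have d_gt0 : (0 < d)%R by rewrite subr_gt0 -lte_fin !fineK.
have step u : V u -> (transition f \+ (fun w => d%:E * dirac_at v w)) u <= f u.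
  move=> Vu /=; rewrite /dirac_at; have [->|_] := eqVneq u v.
    by rewrite mule1 EFinB !fineK// addeCA subee// adde0.
  by rewrite mule0 adde0 fS.
have d0 w : 0 <= d%:E * dirac_at v w.
  by rewrite mule_ge0 ?dirac_at_ge0// lee_fin ltW.
have sum0 n u : 0 <= \sum_(k < n) iter k transition (dirac_at v) u.
  apply: sume_ge0 => k _; apply: iter_transition_ge0 => w.
  exact: dirac_at_ge0.
have bound n u : V u -> iter n transition f u +
    d%:E * \sum_(k < n) iter k transition (dirac_at v) u <= f u.
  elim: n u => [|n IH] u Vu; first by rewrite big_ord0 mule0 adde0.
  rewrite big_ord_recr /= ge0_muleDr; last 2 first.
  - exact: sum0.
  - by apply: iter_transition_ge0 => w; exact: dirac_at_ge0.
  rewrite addeCA addeC; apply: le_trans (IH u Vu); rewrite leeD2r//.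
  have := @iter_transition_le n _ _ u step Vu.
  rewrite iter_transitionD//; last by move=> w; exact: transition_ge0.
  rewrite iter_transitionZ ?(ltW d_gt0)//=; last exact: dirac_at_ge0.
  by rewrite -iterSr.
(* With this bound the left side of [bound] is at least 2, whereas [f v] is at most 1. *)
have [n Mn] := div (2 / d)%R.
have := le_trans (bound n v Vv) (f1 v Vv).
apply/negP; rewrite -ltNge.
apply: (@lt_le_trans _ _ (2%:E : \bar R)); first by rewrite lte_fin ltr1n.
apply: (@le_trans _ _ (d%:E * \sum_(k < n) iter k transition (dirac_at v) v)).
  rewrite -[2%R](@mulfVK _ d) ?gt_eqF// mulrC EFinM.
  by apply: lee_wpmul2l => //; rewrite lee_fin ltW.
by rewrite leeDr// iter_transition_ge0.
Qed.

(** Each iterate [P^m f] is again superharmonic and bounded by [P^m 1 = 1], so the one-step equality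
    applies to it in turn. *)
Lemma superharmonic_recurrent_iter m f v : V v -> (forall w, 0 <= f w) ->
  (forall w, V w -> f w <= 1) -> superharmonic f ->
  (forall M : R, exists n,
     M%:E <= \sum_(k < n) iter k transition (dirac_at v) v) ->
  iter m transition f v = f v.
Proof.
move=> Vv f0 f1 fS div; elim: m => //= m <-.
apply: superharmonic_recurrent => // [w|w Vw|].
- exact: iter_transition_ge0.
- rewrite -[leRHS](@iter_transition1 m w Vw).
  exact: iter_transition_le.
- exact: superharmonic_iter.
Qed.

(** * Weights of paths visiting [v], and their limit *)

Lemma hit_weight_ge0 v n u : 0 <= hit_weight v n u.
Proof.
apply: esum_ge0 => s _.
by rewrite mule_ge0 ?lee_fin ?path_weight_ge0//; case: ifP.
Qed.

Lemma hit_weight_le1 v n u : V u -> hit_weight v n u <= 1.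
Proof.
move=> Vu; rewrite -[leRHS](@iter_transition1 n u Vu) iter_transition_paths//.
apply: le_esum => s _; apply: lee_wpmul2l.
  by rewrite lee_fin path_weight_ge0.
by case: ifP.
Qed.

Lemma hit_weight_self v n : V v -> hit_weight v n v = 1.
Proof.
move=> Vv; rewrite -[RHS](@iter_transition1 n v Vv) iter_transition_paths//.
by apply: eq_esum => s _; rewrite mem_head.
Qed.

(** First-step decomposition: a path from [u] other than [v] can only visit [v] after its first
    step. *)
Lemma hit_weightS v n u : u != v ->
  hit_weight v n.+1 u = transition (hit_weight v n) u.
Proof.
move=> uv; rewrite /hit_weight esum_size_recl; last first.
  by move=> s; rewrite mule_ge0 ?lee_fin ?path_weight_ge0//; case: ifP.
apply: eq_esum => x _; rewrite -esumZl//; last first.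
  by move=> s; rewrite mule_ge0 ?lee_fin ?path_weight_ge0//; case: ifP.
by apply: eq_esum => s _; rewrite in_cons eq_sym (negbTE uv)/= EFinM muleA.
Qed.

(** By induction on [n]: at [v] the weight is constantly 1, and elsewhere the first-step
    decomposition carries the inequality over, starting from weight 0 at length 0. *)
Lemma hit_weight_nondecreasing v u : V v -> V u ->
  nondecreasing_seq (fun n => hit_weight v n u).
Proof.
move=> Vv Vu; apply/nondecreasing_seqP => n; elim: n u Vu => [|n IH] u Vu;
  (have [->|uv] := eqVneq u v; first by rewrite !hit_weight_self).
  rewrite (_ : hit_weight v 0 u = 0) ?hit_weight_ge0//.
  apply: esum1 => s /= /size0nil ->.
  by rewrite in_cons eq_sym (negbTE uv) mule0.
rewrite !hit_weightS//; apply: transition_le => w pw.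
exact/IH/(V_closed Vu pw).
Qed.

Lemma hit_weight_cvg1 o v : V o -> V v ->
  (forall M : R, exists n,
     M%:E <= \sum_(k < n) iter k transition (dirac_at v) v) ->
  (exists m, 0 < iter m transition (dirac_at o) v) ->
  hit_weight v n o @[n --> \oo] --> (1 : \bar R).
Proof.
move=> Vo Vv div [m vo].
pose a u := ereal_sup (range (fun n => hit_weight v n u)).
have hit_cvg u : V u -> hit_weight v n u @[n --> \oo] --> a u.
  move=> Vu; apply: ereal_nondecreasing_cvgn.
  exact: hit_weight_nondecreasing.
have hit_le n u : hit_weight v n u <= a u by apply: ereal_sup_ubound; exists n.
have a0 u : 0 <= a u by exact: le_trans (hit_weight_ge0 v 0 u) (hit_le 0%N u).
have a1 u : V u -> a u <= 1.
  by move=> Vu; apply: ge_ereal_sup => _ [n _ <-]; exact: hit_weight_le1.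
have av : a v = 1.
  by apply/eqP; rewrite eq_le a1//= -(@hit_weight_self v 0 Vv).
(* Away from [v], Fatou is applied to the first-step decomposition; at [v] the claim is
   [P a v <= 1], as [a v = 1]. *)
have aS : superharmonic a.
  move=> u Vu; apply: (@transition_limit_le (hit_weight v)) => [n w|w pw|n].
  - exact: hit_weight_ge0.
  - exact: hit_cvg (V_closed Vu pw).
  - have [->|uv] := eqVneq u v.
      rewrite av -[leRHS](transition1 Vv); apply: transition_le => w pw.
      exact: hit_weight_le1 (V_closed Vv pw).
    by rewrite -hit_weightS.
suff ao : a o = 1 by rewrite -ao; exact: hit_cvg.
apply/eqP; rewrite eq_le a1//= leNgt; apply/negP => ao_lt1.
have ao_fin : a o \is a fin_num.
  by rewrite ge0_fin_numE// (lt_trans ao_lt1) ?ltry.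
pose d := (1 - fine (a o))%R.
have d_gt0 : (0 < d)%R by rewrite subr_gt0 -lte_fin fineK.
have step u : V u -> (a \+ (fun w => d%:E * dirac_at o w)) u <= cst 1 u.
  move=> Vu /=; rewrite /dirac_at; have [->|_] := eqVneq u o.
    by rewrite mule1 EFinB fineK// addeCA subee// adde0.
  by rewrite mule0 adde0 a1.
have := @iter_transition_le m _ _ v step Vv.
rewrite iter_transition1// iter_transitionD//; last first.
  by move=> w; rewrite mule_ge0 ?dirac_at_ge0// lee_fin ltW.
rewrite iter_transitionZ ?(ltW d_gt0)//=; last exact: dirac_at_ge0.
(* Here [P^m a v = a v = 1], so [step] would give [1 + d * P^m 1_o v <= 1] with a positive second
   summand. *)
rewrite (superharmonic_recurrent_iter m Vv)// av.
apply/negP; rewrite -ltNge lteDl// mule_gt0//.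
Qed.

End StochasticOn.

End TransitionOperator.


(** * Walks on the vertices expressed through the transition operator *)

Section Walks.
Variables (R : realType) (h : weight R).
Local Notation p := (edge_weight h).

Lemma edge_weight_ge0 u w : 0 <= p u w.
Proof. by rewrite /edge_weight; case: insubP => // e _ _; exact: ge0. Qed.

Lemma edge_weightC u w : p u w = p w u.
Proof. by rewrite /edge_weight fsetUC. Qed.

Lemma edge_weightxx u : p u u = 0.
Proof. by rewrite /edge_weight insubF// cardfs2 eqxx. Qed.

Lemma walk_weight_cons u s : walk_weight h (u :: s) = path_weight p u s.
Proof.
rewrite /walk_weight big_add1 /=.
elim: s u => [|x s IH] u /=; first by rewrite big_nil.
by rewrite big_nat_recl//= IH.
Qed.

Lemma path_weight_neq0 u s :
  path_weight p u s != 0 -> path (fun x y => x != y) u s.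
Proof.
elim: s u => //= x s IH u; rewrite mulf_eq0 negb_or => /andP[ux /IH ->].
by rewrite andbT; apply: contraNneq ux => ->; rewrite edge_weightxx.
Qed.

(* A step from [u] to [u] has weight 0, so the walk condition can be dropped. *)
Lemma esum_walks n (Q : pred (seq vertex)) :
  \esum_(w in walks n `&` [set w | Q w]) (walk_weight h w)%:E =
  \esum_(s in [set s | size s = n]) ((path_weight p vertex1 s)%:E *
    (if Q (vertex1 :: s) then 1 else 0))%E.
Proof.
pose C := [set w : seq vertex | size w = n.+1 /\ head vertex1 w = vertex1].
rewrite (_ : _ `&` _ = C `&` [set w | sorted (fun x y => x != y) w && Q w]).
  rewrite esum_mkcondr.
  rewrite (@reindex_esum _ _ _ [set s | size s = n] C (cons vertex1)).
    apply: eq_esum => s _; rewrite walk_weight_cons.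
    rewrite (_ : _ \in _ =
        path (fun x y => x != y) vertex1 s && Q (vertex1 :: s)).
      have [_|/negP npath] := boolP (path _ _ s) => /=.
        by case: ifP; rewrite ?mule1 ?mule0.
      have -> : path_weight p vertex1 s = 0.
        by apply/eqP; apply: contra_notT npath; exact: path_weight_neq0.
      by rewrite mul0e.
    by apply/idP/idP; rewrite inE.
  split.
  - by move=> s /= sn; split => //=; rewrite sn.
  - by move=> s t _ _ [].
  - by move=> [|x s] [//= [sn] ->]; exists s.
apply/seteqP; split => w /=.
- by move=> [[/andP[/eqP ? ?] ?] ?]; split => //; apply/andP.
- move=> [[? ?] /andP[? ?]]; split => //; split => //.
  by apply/andP; split => //; apply/eqP.
Qed.

Lemma reachableP u :
  reachable h u <->
  exists2 s, last vertex1 s = u & path_weight p vertex1 s != 0.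
Proof.
split=> [[n [[|x s] [[/andP[//= _ _] /= ->] lastu]]]|[s lastu s0]].
  by rewrite walk_weight_cons; exists s.
exists (size s), (vertex1 :: s); rewrite walk_weight_cons; split => //.
by split => //; rewrite /is_walk eqxx /=; exact: path_weight_neq0.
Qed.

Lemma reachable_vertex1 : reachable h vertex1.
Proof. by apply/reachableP; exists [::] => //=; rewrite oner_eq0. Qed.

Lemma reachable_closed u w : reachable h u -> p u w != 0 -> reachable h w.
Proof.
move=> /reachableP[s <- s0] pw; apply/reachableP; exists (rcons s w).
  by rewrite last_rcons.
by rewrite path_weight_rcons mulf_neq0.
Qed.

Lemma convex_transition1 u : convex_weight h -> reachable h u ->
  transition p (cst 1%E) u = 1%E.
Proof.
move=> [_ conv] /conv ru; rewrite -[RHS]ru esum_mkcond [RHS]esum_mkcond.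
apply: eq_esum => w _.
rewrite in_setT mule1; case: ifPn => //; rewrite notin_setE /= => /negP.
by rewrite negbK => /eqP ->; rewrite edge_weightxx.
Qed.

(** Symmetry of the weight lets a path from [vertex1] be retraced, last edge first. *)
Lemma reachable_sym u : reachable h u ->
  exists m, (0 < iter m (transition p) (dirac_at R vertex1) u)%E.
Proof.
have dirac0 w : (0 <= dirac_at R vertex1 w)%E by exact: dirac_at_ge0.
move=> /reachableP[s <-]; elim/last_ind: s => [_|s x IH].
  by exists 0%N; rewrite /= /dirac_at eqxx.
rewrite path_weight_rcons mulf_eq0 negb_or last_rcons => /andP[/IH[m m0] px].
exists m.+1 => /=.
apply: lt_le_trans (transition_ge_term edge_weight_ge0 x (last vertex1 s) _).
  by rewrite mule_gt0// lte_fin edge_weightC lt0r px edge_weight_ge0.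
by move=> w; exact: iter_transition_ge0 edge_weight_ge0 _ _ _ dirac0.
Qed.

Lemma b_E n : convex_weight h ->
  (b_ h n)%:E = iter n (transition p) (dirac_at R vertex1) vertex1.
Proof.
move=> conv.
have dirac0 w : (0 <= dirac_at R vertex1 w)%E by exact: dirac_at_ge0.
have -> : b_ h n = fine (iter n (transition p) (dirac_at R vertex1) vertex1).
  rewrite iter_transition_paths//; last exact: edge_weight_ge0.
  rewrite /b_ /set_weight /closed_walks.
  rewrite (_ : [set w | _] = [set w | last vertex1 w == vertex1]).
    by rewrite esum_walks.
  by apply/seteqP; split => w /= /eqP.
(* Since [fine] sends infinity to 0, finiteness must be shown; it follows from
   [P^n 1_1 <= P^n 1 = 1]. *)
rewrite fineK// ge0_fin_numE; last first.
  exact: iter_transition_ge0 edge_weight_ge0 _ _ _ _.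
apply: (@le_lt_trans _ _ 1%E); last exact: ltry.
rewrite -[leRHS](@iter_transition1 _ _ p edge_weight_ge0 _ reachable_closed
  (fun u => @convex_transition1 u conv) n vertex1 reachable_vertex1).
apply: iter_transition_le reachable_closed _ _ _ _ _ _ => //.
- exact: edge_weight_ge0.
- by move=> w _; rewrite /dirac_at; case: ifP.
- exact: reachable_vertex1.
Qed.

Lemma a_E v n : a_ h v n = fine (hit_weight p v n vertex1).
Proof. by rewrite /a_ /set_weight (esum_walks n (fun w => v \in w)). Qed.

(** The bijection commutes with [P] and takes [vertex1] to [v], so the return weights at both
    vertices agree. *)
Lemma transitive_recurrent v (M : R) : convex_weight h -> transitive_at v h ->
  diverges_at_1 (b_ h) ->
  exists n, (M%:E <= \sum_(k < n) iter k (transition p) (dirac_at R v) v)%E.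
Proof.
move=> conv [phi [bij_phi phi1 p_phi]] /cvgryPge/(_ M)[n _ /(_ n (leqnn n)) Mn].
have p_phi' a b : p (phi a) (phi b) = p a b.
  (* Transitivity covers distinct vertices; on the diagonal both sides are 0. *)
  by have [->|/p_phi//] := eqVneq a b; rewrite !edge_weightxx.
(* The partial sum in [diverges_at_1] includes the index [n], hence [n.+1] terms. *)
exists n.+1; rewrite -lee_fin big_mkord -sumEFin in Mn.
rewrite (le_trans Mn)// le_eqVlt; apply/orP; left; apply/eqP.
apply: eq_bigr => k _; rewrite b_E// -phi1.
rewrite -[RHS]/((iter k (transition p) (dirac_at R (phi vertex1)) \o phi)
  vertex1).
rewrite iter_transition_equivariant//; congr (iter _ _ _ _).
by apply/funext => u; rewrite /dirac_at /= (inj_eq (bij_inj bij_phi)).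
Qed.

End Walks.

Theorem theorem12 (R : realType) (v : vertex) (h : weight R)
    (v_neq1 : v != vertex1)
    (h_light : light h)
    (h_convex : convex_weight h)
    (h_transitive : transitive_at v h)
    (v_reachable : reachable h v)
    (B_diverges : diverges_at_1 (b_ h)) :
  a_ h v n @[n --> \oo] --> (1 : R).
Proof.
under eq_fun do rewrite a_E.
(* The closed set on which the kernel is stochastic is [V(h)]; the extended real limit 1 is finite,
   so it passes through [fine]. *)
apply: fine_cvg; apply: (@hit_weight_cvg1 _ _ _ _ (reachable h)).
- exact: edge_weight_ge0.
- exact: reachable_closed.
- by move=> u; exact: convex_transition1.
- exact: reachable_vertex1.
- exact: v_reachable.
- by move=> M; exact: transitive_recurrent.
- exact: reachable_sym.
Qed.
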